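(* Let $\Omega=(0,1)\subset\mathbb{R}$ and let $u_0,u_1\in\mathbb{R}$. Let $u^\varepsilon\in H^1(\Omega)$ be the unique weak solution of the one-dimensional advection-diffusion problem with right-hand side $f=0$ and Dirichlet boundary conditions $u_0,u_1$, that is, $$u^\varepsilon(0)=u_0,\quad u^\varepsilon(1)=u_1,\qquad a^\varepsilon(u^\varepsilon,v)=0\quad\text{for all } v\in H^1_0(\Omega).$$ Let $u_H^{\varepsilon,\mathrm{adv}}\in V_H^{\varepsilon,\mathrm{adv}}$ be its Adv-MsFEM-lin approximation, that is, the unique element of $V_H^{\varepsilon,\mathrm{adv}}$ such that $$u_H^{\varepsilon,\mathrm{adv}}(0)=u_0,\quad u_H^{\varepsilon,\mathrm{adv}}(1)=u_1,\qquad a^\varepsilon\big(u_H^{\varepsilon,\mathrm{adv}},v_H\big)=0\quad\text{for all } v_H\in V_H^{\varepsilon,\mathrm{adv}}\cap H^1_0(\Omega).$$ Then $u_H^{\varepsilon,\mathrm{adv}}=u^\varepsilon$.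
   Context: The diffusion coefficient $A^\varepsilon\in L^\infty(\Omega)$ satisfies $m\le A^\varepsilon(x)\le M$ for almost all $x\in\Omega$, with constants $0<m\le M$. The advection field $b\in L^\infty(\Omega)$ is divergence-free (i.e. $b$ is constant in dimension one). The bilinear form is $$a^\varepsilon(u,v)=\int_\Omega A^\varepsilon u'v'+v\,b\,u',\qquad u,v\in H^1(\Omega),$$ associated with the operator $\mathcal{L}^\varepsilon u=-(A^\varepsilon u')'+b\,u'$. Mesh: $0=x_0<x_1<\dots<x_N<x_{N+1}=1$ is a subdivision of $\Omega$ into the $N+1$ intervals $(x_j,x_{j+1})$, $j=0,\dots,N$. Adv-MsFEM-lin basis functions: for $i=0,\dots,N+1$, $\phi_i^{\varepsilon,\mathrm{adv}}\in H^1(\Omega)$ is the unique function such that $\phi_i^{\varepsilon,\mathrm{adv}}(x_j)=\delta_{i,j}$ for all $j=0,\dots,N+1$ and $\mathcal{L}^\varepsilon\phi_i^{\varepsilon,\mathrm{adv}}=0$ in each interval $(x_j,x_{j+1})$ in the weak sense, i.e. $a^\varepsilon(\phi_i^{\varepsilon,\mathrm{adv}},v)=0$ for all $v\in H^1_0(x_j,x_{j+1})$ (extended by zero to $\Omega$), $j=0,\dots,N$. The approximation space is $V_H^{\varepsilon,\mathrm{adv}}=\operatorname{Span}\{\phi_i^{\varepsilon,\mathrm{adv}},\ 0\le i\le N+1\}$. *)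

(* Defs.v *)
From mathcomp Require Import all_boot all_order all_algebra.
From mathcomp Require Import all_classical all_reals all_analysis.

Set Implicit Arguments.
Unset Strict Implicit.
Unset Printing Implicit Defensive.

Import Order.TTheory GRing.Theory Num.Theory.
Import numFieldNormedType.Exports.

Local Open Scope classical_set_scope.
Local Open Scope ring_scope.

(* f belongs to L^p(a, b); only the values of f on ]a, b[ matter. *)
Definition Lp (R : realType) (p : \bar R) (a b : R) (f : R -> R) : Prop :=
  f \_ `]a, b[ \in Lfun (@lebesgue_measure R) p.

(* phi belongs to C^1_c(a, b). The support is closed and bounded, hence
   compact, as soon as it is contained in ]a, b[. *)
Definition test_function (R : realType) (a b : R) (phi : R -> R) : Prop :=
  [/\ forall x, derivable phi x 1,
      continuous (derive1 phi) &
      closure [set x | phi x != 0] `<=` `]a, b[].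

(* g is a derivative of u on ]a, b[ in the sense of distributions. *)
Definition is_weak_derivative (R : realType) (a b : R) (u g : R -> R) : Prop :=
  forall phi, test_function a b phi ->
    \int[lebesgue_measure]_(x in `]a, b[) (u x * derive1 phi x) =
    - \int[lebesgue_measure]_(x in `]a, b[) (g x * phi x).

(* Elements of H^1(a, b) are given by their continuous representative on
   [a, b], so that point values are meaningful; values outside [a, b] are
   irrelevant. *)
Definition H1 (R : realType) (a b : R) (u : R -> R) : Prop :=
  [/\ {within `[a, b], continuous u},
      Lp 2%:E a b u &
      exists2 g, Lp 2%:E a b g & is_weak_derivative a b u g].

Definition H10 (R : realType) (a b : R) (u : R -> R) : Prop :=
  [/\ H1 a b u, u a = 0 & u b = 0].

(* A chosen representative of the weak derivative in L^2(a, b), which is unique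
   almost everywhere; junk value 0 when there is none. *)
Definition wderiv (R : realType) (a b : R) (u : R -> R) : R -> R :=
  xget (cst 0) [set g | Lp 2%:E a b g /\ is_weak_derivative a b u g].

(* In dimension one the divergence is the derivative, in the sense of
   distributions on the domain ]0, 1[; b is then a constant a.e. *)
Definition divergence_free (R : realType) (b : R -> R) : Prop :=
  is_weak_derivative 0 1 b (cst 0).

Definition aform (R : realType) (A b u v : R -> R) : R :=
  \int[lebesgue_measure]_(x in `]0, 1[)
    (A x * wderiv 0 1 u x * wderiv 0 1 v x + v x * b x * wderiv 0 1 u x).

(* 0 = x 0 < x 1 < ... < x N < x N.+1 = 1; later values of x are irrelevant. *)
Definition mesh (R : realType) (N : nat) (x : nat -> R) : Prop :=
  [/\ x 0 = 0, x N.+1 = 1 & forall j, (j <= N)%N -> x j < x j.+1].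

(* In the last condition, v \_ `[x j, x j.+1] is the extension of v by zero. *)
Definition adv_msfem_basis (R : realType) (A b : R -> R) (N : nat)
    (x : nat -> R) (phi : 'I_N.+2 -> R -> R) : Prop :=
  forall i,
    [/\ H1 0 1 (phi i),
        forall j : 'I_N.+2, phi i (x j) = (i == j)%:R &
        forall (j : 'I_N.+1) (v : R -> R), H10 (x j) (x j.+1) v ->
          aform A b (phi i) (v \_ `[x j, x j.+1]) = 0].

(* Functions are identified when they agree on [0, 1]. *)
Definition adv_msfem_space (R : realType) (N : nat) (phi : 'I_N.+2 -> R -> R)
    : set (R -> R) :=
  [set v | exists c : 'I_N.+2 -> R,
     {in `[0, 1], forall y, v y = \sum_i c i * phi i y}].

Definition weak_solution (R : realType) (A b : R -> R) (u0 u1 : R)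
    (u : R -> R) : Prop :=
  [/\ H1 0 1 u, u 0 = u0, u 1 = u1 &
      forall v, H10 0 1 v -> aform A b u v = 0].

Definition adv_msfem_solution (R : realType) (A b : R -> R) (N : nat)
    (phi : 'I_N.+2 -> R -> R) (u0 u1 : R) (uH : R -> R) : Prop :=
  [/\ adv_msfem_space phi uH, uH 0 = u0, uH 1 = u1 &
      forall vH, adv_msfem_space phi vH -> H10 0 1 vH -> aform A b uH vH = 0].

(* Main.v *)
Require Import Defs.
From mathcomp Require Import all_boot all_order all_algebra.
From mathcomp Require Import all_classical all_reals all_analysis.
From mathcomp Require Import measurable_realfun ess_sup_inf.
From mathcomp Require Import ring lra.

(** In dimension one a multiscale Galerkin solution with right-hand side zero
    is already a weak solution of the whole problem, so that the result is an
    instance of uniqueness.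

    Every v in H^1_0(0, 1) splits as v = vH + w, where vH = sum_i v(x_i) phi_i
    interpolates v at the nodes. As the interpolant vanishes at 0 and 1, it
    lies in the discrete test space, and the Galerkin equations make the form
    vanish on (uH, vH). The remainder w vanishes at all nodes, hence is a sum
    of bubbles in H^1_0(x_j, x_{j+1}); each basis function, and therefore uH,
    is annihilated by bubbles. So the form vanishes on (uH, v)
    (adv_msfem_solution_weak). For the difference e of two weak solutions,
    testing with e gives int A e'^2 + C int e e' = 0, where C is the constant
    value of b. Here int e e' = 0 because e vanishes at both ends, so e' = 0 by
    ellipticity and e = e(0) = 0 (weak_solution_unique).

    These manipulations require the structure theory of H^1 in dimension one:
    u belongs to H^1(a, b) exactly when u is, up to a constant, the primitive of
    some g in L^2(a, b), and g is then almost everywhere the chosen weak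
    derivative (wderiv_L2_primitive, L2_primitive_H1, wderivE). The two facts
    behind this are an integration by parts for primitives of integrable
    functions, proved by applying Fubini's theorem on a triangle
    (primitive_by_parts), and the lemma of du Bois-Reymond: an integrable
    function whose weak derivative is zero is almost everywhere constant
    (duBoisReymond). The latter also turns a divergence-free b into a constant,
    and then an integration by parts rewrites the form, for v in H^1_0, as the
    pairing int (A u' - C u) v' of a flux with the derivative of v (aformE).
    This expression depends on v only through v', linearly, so that splitting v
    amounts to splitting an integral, over the mesh intervals for w. *)

Set Implicit Arguments.
Unset Strict Implicit.
Unset Printing Implicit Defensive.

Import Order.TTheory GRing.Theory Num.Theory.
Import numFieldNormedType.Exports.

Local Open Scope classical_set_scope.
Local Open Scope ring_scope.

Local Notation mu := lebesgue_measure.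
Local Notation L1 f := (integrable mu [set: _] (EFin \o f)).

(** * Integrable functions on the line and their primitives *)

(* The filter of almost every point, stated at Lebesgue measure so that filterS
   and near apply to the almost everywhere statements below. *)
#[local] Instance ae_lebesgue_filter (R : realType) :
  Filter (nbhs (almost_everywhere (@lebesgue_measure R))) :=
  ae_filter_ringOfSetsType _.

(** Integrating from -oo makes the primitive a function on the whole line, with
    the same base point for every interval: functions on ]a, b[ are first
    extended by zero, and the primitive then vanishes at a. *)
Definition primitive (R : realType) (f : R -> R) (x : R) : R :=
  \int[mu]_(t in `]-oo, x]) f t.

Section L1space.
Context {R : realType}.
Implicit Types (f g : R -> R) (a b c d x y : R).

Lemma L1S f (D : set R) : measurable D -> L1 f -> mu.-integrable D (EFin \o f).
Proof. by move=> mD; apply: integrableS. Qed.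

Lemma L1_measurable f : L1 f -> measurable_fun setT f.
Proof. by move=> /measurable_int /measurable_EFinP. Qed.

Lemma L1_restrict f (D : set R) : measurable D ->
  mu.-integrable D (EFin \o f) <-> L1 (f \_ D).
Proof. by move=> mD; rewrite integrable_mkcond// restrict_EFin. Qed.

Lemma L1Z c f : L1 f -> L1 (fun x => c * f x).
Proof. by move=> lf; exact: (integrableZl measurableT c lf). Qed.

Lemma L1B f g : L1 f -> L1 g -> L1 (fun x => f x - g x).
Proof. by move=> lf lg; exact: (integrableB measurableT lf lg). Qed.

Lemma L1_bounded f g M : L1 f -> measurable_fun setT g ->
  (forall x, `|g x| <= M) -> L1 (fun x => f x * g x).
Proof.
move=> lf mg gM.
apply: (@le_integrable _ _ _ mu _ measurableT _ (EFin \o (fun x => M * f x))).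
- by apply/measurable_EFinP; apply: measurable_funM => //; exact: L1_measurable.
- move=> x _ /=; rewrite lee_fin normrM normrM [leRHS]mulrC ler_wpM2l//.
  by rewrite (le_trans (gM x))// ler_norm.
- exact: L1Z.
Qed.

Lemma ae_eq_Rintegral (D : set R) f g : measurable D ->
  measurable_fun D f -> measurable_fun D g -> ae_eq mu D f g ->
  \int[mu]_(x in D) f x = \int[mu]_(x in D) g x.
Proof.
move=> mD mf mg fg; rewrite /Rintegral; congr fine; apply: ae_eq_integral => //.
- exact/measurable_EFinP.
- exact/measurable_EFinP.
- by apply: filterS fg => x fg /fg /= ->.
Qed.

Lemma primitiveB f x y : L1 f -> x <= y ->
  primitive f y - primitive f x = \int[mu]_(t in `]x, y]) f t.
Proof.
move=> lf xy; rewrite /primitive Rintegral_itvB//; exact: L1S.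
Qed.

(** On a neighbourhood of x this is, up to a constant, the continuity of the
    integral in its upper bound on a compact interval. *)
Lemma primitive_continuous f : L1 f -> continuous (primitive f).
Proof.
move=> lf x.
have ax : x - 1 < x + 1 by lra.
apply: (@within_continuous_continuous _ _ _ (x - 1) (x + 1)) => //; last first.
  by rewrite in_itv/=; lra.
have H : {within `[x - 1, x + 1], continuous
   (cst (primitive f (x - 1)) \+ (fun y => parameterized_integral mu (x - 1) y f))}.
  move=> y; apply: continuousD; first exact: cst_continuous.
  apply: parameterized_integral_continuous; first exact: ltW.
  exact: L1S.
apply: subspace_eq_continuous H => y; rewrite inE/= in_itv/= => /andP[xy _] /=.
rewrite /from_subspace/=.
apply/esym/eqP; rewrite addrC -subr_eq primitiveB// /parameterized_integral.
by rewrite Rintegral_itv_obnd_cbnd//; exact: L1S.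
Qed.

Lemma primitiveD f g x : L1 f -> L1 g ->
  primitive (fun t => f t + g t) x = primitive f x + primitive g x.
Proof. by move=> lf lg; rewrite /primitive RintegralD//; exact: L1S. Qed.

Lemma primitiveZ c f x : L1 f ->
  primitive (fun t => c * f t) x = c * primitive f x.
Proof. by move=> lf; rewrite /primitive RintegralZl//; exact: L1S. Qed.

Lemma eq_primitive f g x : L1 f -> L1 g -> ae_eq mu setT f g ->
  primitive f x = primitive g x.
Proof.
move=> lf lg fg; apply: ae_eq_Rintegral => //.
- exact: measurable_funTS (L1_measurable lf).
- exact: measurable_funTS (L1_measurable lg).
- by apply: filterS fg => y /(_ I) ->.
Qed.

Lemma primitive_bounded f x : L1 f -> `|primitive f x| <= \int[mu]_t `|f t|.
Proof.
move=> lf; rewrite (le_trans (le_normr_Rintegral _ _))//; first exact: L1S.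
rewrite [leLHS]Rintegral_mkcond le_Rintegral//.
- apply/(L1_restrict _ _).1 => //.
  by apply: L1S => //; exact: integrable_norm.
- exact: integrable_norm.
- by move=> t _; rewrite patchE; case: ifP => _; rewrite ?lexx ?normr_ge0.
Qed.

Lemma primitive_supp f a x : (forall t, t <= a -> f t = 0) -> x <= a ->
  primitive f x = 0.
Proof.
move=> f0 xa; rewrite /primitive (@eq_Rintegral _ _ _ _ _ (cst 0)).
  by rewrite Rintegral_cst// mul0r.
by move=> t; rewrite inE/= in_itv/= => tx; rewrite f0// (le_trans tx).
Qed.

Lemma primitive_supp_ge f b x : L1 f -> (forall t, b <= t -> f t = 0) -> b <= x ->
  primitive f x = \int[mu]_t f t.
Proof.
move=> lf f0 bx; rewrite /primitive Rintegral_mkcond; apply: eq_Rintegral.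
move=> t _; rewrite patchE; case: ifPn => //; rewrite notin_setE/= in_itv/= => /negP.
by rewrite -ltNge => xt; rewrite f0// (le_trans bx)// ltW.
Qed.
End L1space.

(** * Integration by parts for primitives *)

Section Byparts.
Context {R : realType}.
Implicit Types (f g : R -> R) (a b c d x y : R).

Lemma EFin_Rintegral (D : set R) f : measurable D ->
  mu.-integrable D (EFin \o f) ->
  (\int[mu]_(x in D) (f x)%:E)%E = (\int[mu]_(x in D) f x)%:E.
Proof. by move=> mD lf; rewrite /Rintegral fineK// integrable_fin_num. Qed.

Lemma primitive_measurable f : L1 f -> measurable_fun setT (primitive f).
Proof. by move=> lf; apply: continuous_measurable_fun; exact: primitive_continuous. Qed.

Lemma L1_mul_primitive f g : L1 f -> L1 g -> L1 (fun x => f x * primitive g x).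
Proof.
move=> lf lg; apply: L1_bounded => //; first exact: primitive_measurable.
by move=> x; exact: primitive_bounded.
Qed.

(** The function g(s) f(t) on the triangle t <= s: integrating it in t first
    produces the primitive of f at s, and in s first the complementary integral
    of g over [t, +oo[. *)
Let triangle f g (z : measurableTypeR R * measurableTypeR R) : R :=
  g z.1 * f z.2 * ((z.2 : R) <= (z.1 : R))%R%:R.

Let measurable_triangle f g : L1 f -> L1 g -> measurable_fun setT (triangle f g).
Proof.
move=> /L1_measurable mf /L1_measurable mg.
apply: measurable_funM.
  apply: measurable_funM.
    exact: (measurableT_comp mg measurable_fst).
  exact: (measurableT_comp mf measurable_snd).
apply: (@measurableT_comp _ _ _ _ _ _ (fun b : bool => b%:R : R)) => //.
by apply: measurable_fun_ler.
Qed.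

Let integral_below f x : L1 f -> 
  L1 (fun t => f t * (t <= x)%R%:R) /\ \int[mu]_t (f t * (t <= x)%R%:R) = primitive f x.
Proof.
move=> lf.
have E : (fun t => f t * (t <= x)%R%:R) = f \_ `]-oo, x].
  apply/funext => t; rewrite patchE; case: ifPn; rewrite ?inE ?notin_setE/= in_itv/=.
    by move=> ->; rewrite mulr1.
  by move=> /negP/negbTE ->; rewrite mulr0.
split; last first.
  rewrite /primitive [RHS]Rintegral_mkcond; apply: eq_Rintegral => t _.
  exact: (congr1 (@^~ t) E).
by rewrite E; apply/(L1_restrict _ _).1 => //; exact: L1S.
Qed.

Let integral_above f x : L1 f -> 
  L1 (fun t => f t * (x <= t)%R%:R) /\ \int[mu]_t (f t * (x <= t)%R%:R) =
    \int[mu]_t f t - primitive f x.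
Proof.
move=> lf.
have E : (fun t => f t * (x <= t)%R%:R) = (fun t => f t - (f \_ `]-oo, x[) t).
  apply/funext => t; rewrite patchE; case: ifPn; rewrite ?inE ?notin_setE/= in_itv/=.
    by rewrite ltNge => /negbTE ->; rewrite mulr0 subrr.
  by move=> /negP; rewrite -leNgt => ->; rewrite mulr1 subr0.
have lr : L1 (f \_ `]-oo, x[) by apply/(L1_restrict _ _).1 => //; exact: L1S.
split; first by rewrite E; exact: L1B.
rewrite E RintegralB//; congr (_ - _).
rewrite -Rintegral_mkcond /primitive Rintegral_itv_bndo_bndc//.
exact: L1S.
Qed.

(** By Tonelli the integral of the absolute value is at most the product of the
    L^1 norms of f and g. *)
Let integrable_triangle f g : L1 f -> L1 g ->
  ((mu : {sigma_finite_measure set (measurableTypeR R) -> \bar R}) \x mu)%E.-integrable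
    setT (EFin \o triangle f g).
Proof.
move=> lf lg; apply/integrable12ltyP; first by apply/measurable_EFinP; exact: measurable_triangle.
have lnf : L1 (fun x => `|f x|) by exact: integrable_norm.
have lng : L1 (fun x => `|g x|) by exact: integrable_norm.
set I := \int[mu]_t `|f t|.
have H : L1 (fun x => I * `|g x|) by exact: L1Z.
move/integrableP : H => [_]; apply: le_lt_trans.
apply: ge0_le_integral => //=.
- by move=> x _; exact: integral_ge0.
- apply: (@measurable_fun_fubini_tonelli_F _ _ _ _ _ mu (fun z => `|(triangle f g z)%:E|%E)) => //=.
  do 2 apply: measurableT_comp => //; exact: measurable_triangle.
- do 2 apply: measurableT_comp => //; apply: measurable_funM => //.
  by apply: measurableT_comp => //; exact: L1_measurable.
move=> x _.
apply: (@le_trans _ _ (\int[mu]_y (`|g x| * `|f y|)%:E)%E).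
  apply: ge0_le_integral => //=.
  - do 2 apply: measurableT_comp => //.
    exact: (measurableT_comp (measurable_triangle _ _) (pair1_measurable x)).
  - apply: measurableT_comp => //; apply: measurable_funM => //.
    by apply: measurableT_comp => //; exact: L1_measurable.
  - move=> y _; rewrite lee_fin /triangle/= normrM normrM ler_piMr//.
    by case: (y <= x); rewrite ?normr1 ?normr0.
rewrite EFin_Rintegral//; last exact: L1Z.
by rewrite RintegralZl// mulrC -/I lee_fin ler_norm.
Qed.

(** The product rule for absolutely continuous functions, with total masses as
    boundary terms. It needs no derivative of the primitives: exchanging the
    order of integration over the triangle suffices. *)
Lemma primitive_by_parts f g : L1 f -> L1 g ->
  \int[mu]_x (primitive f x * g x) + \int[mu]_x (f x * primitive g x) =
  (\int[mu]_x f x) * (\int[mu]_x g x).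
Proof.
move=> lf lg.
have := Fubini (integrable_triangle lf lg).
rewrite [LHS](_ : _ = (\int[mu]_x (primitive f x * g x))%:E); last first.
  rewrite -EFin_Rintegral//; last first.
    have := L1_mul_primitive lg lf.
    by under eq_fun do rewrite mulrC.
  apply: eq_integral => x _.
  have [l e] := integral_below x lf.
  rewrite (_ : (fun y => _) = EFin \o (fun t => g x * (f t * (t <= x)%R%:R))); last first.
    by apply/funext => t; rewrite /triangle/= mulrA.
  by rewrite EFin_Rintegral//; [rewrite RintegralZl// e mulrC|exact: L1Z].
have lB : L1 (fun t => (\int[mu]_x g x) * f t - f t * primitive g t).
  by apply: L1B; [exact: L1Z|exact: L1_mul_primitive].
rewrite [RHS](_ : _ = (\int[mu]_t ((\int[mu]_x g x) * f t - f t * primitive g t))%:E); last first.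
  rewrite -EFin_Rintegral//; apply: eq_integral => t _.
  have [l e] := integral_above t lg.
  rewrite (_ : (fun x => _) = EFin \o (fun x => f t * (g x * (t <= x)%R%:R))); last first.
    by apply/funext => x; rewrite /triangle/= mulrA [f t * _]mulrC.
  rewrite EFin_Rintegral//; last exact: L1Z.
  by rewrite RintegralZl// e mulrBr mulrC.
rewrite RintegralB//; [|exact: L1Z|exact: L1_mul_primitive].
rewrite RintegralZl// => -[->].
by rewrite subrK mulrC.
Qed.
End Byparts.

(** * Test functions as primitives *)

Section Test_functions.
Context {R : realType}.
Implicit Types (f g phi psi : R -> R) (a b c d x y : R).

Lemma continuous_supp_L1 psi c d : continuous psi ->
  (forall x, x \notin `]c, d[ -> psi x = 0) -> L1 psi.
Proof.
move=> cpsi psi0.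
have -> : psi = psi \_ `[c, d].
  apply/funext => x; rewrite patchE; case: ifPn => // /negP; rewrite inE => xcd.
  by apply: psi0; apply: contra_notN xcd; exact: subset_itv_oo_cc.
apply/(L1_restrict _ _).1 => //.
apply: continuous_compact_integrable; first exact: segment_compact.
exact: continuous_subspaceT.
Qed.

Lemma continuous_supp_bounded psi c d : continuous psi ->
  (forall x, x \notin `]c, d[ -> psi x = 0) ->
  exists M, forall x, `|psi x| <= M.
Proof.
move=> cpsi psi0.
have : compact (psi @` `[c, d]).
  apply: continuous_compact; last exact: segment_compact.
  exact: continuous_subspaceT.
move=> /compact_bounded[M [_ /(_ (`|M| + 1))]].
have -> : M < `|M| + 1 by rewrite (le_lt_trans (ler_norm M))// ltrDl.
move=> /(_ isT) B; exists (`|M| + 1) => x.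
have [xcd|xcd] := boolP (x \in `]c, d[).
  by apply: B => /=; exists x => //; exact: subset_itv_oo_cc.
by rewrite psi0// normr0 addr_ge0.
Qed.

Lemma primitive_derive psi c d x : continuous psi ->
  (forall x, x \notin `]c, d[ -> psi x = 0) ->
  derivable (primitive psi) x 1 /\ derive1 (primitive psi) x = psi x.
Proof.
move=> cpsi psi0; apply: (@continuous_FTC1 _ psi -oo%O x (x + 1)).
- lra.
- by apply: L1S => //; exact: (continuous_supp_L1 cpsi psi0).
- exact: ltNyr.
- exact: cpsi.
Qed.

(** The zero mean makes the primitive vanish to the right of d as well as to the
    left of c, so that it has compact support. *)
Lemma primitive_test_function a b c d psi : a < c -> d < b ->
  continuous psi -> (forall x, x \notin `]c, d[ -> psi x = 0) ->
  \int[mu]_x psi x = 0 -> test_function a b (primitive psi).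
Proof.
move=> ac db cpsi psi0 Ipsi.
have D x := primitive_derive x cpsi psi0.
have lpsi := continuous_supp_L1 cpsi psi0.
split.
- by move=> x; case: (D x).
- rewrite (_ : derive1 _ = psi)//; apply/funext => x; by case: (D x).
- apply: (@subset_trans _ `[c, d]); last first.
    move=> y /=; rewrite !in_itv/= => /andP[cy yd].
    by rewrite (lt_le_trans ac cy) (le_lt_trans yd db).
  rewrite closureE; apply: smallest_sub; first exact: interval_closed.
  move=> x /=; apply: contra_neqP => /negP; rewrite in_itv/= negb_and -!ltNge => /orP[xc|dx].
    apply: (@primitive_supp _ _ c); last exact: ltW.
    by move=> t tc; apply: psi0; rewrite in_itv/= ltNge tc.
  rewrite (@primitive_supp_ge _ _ d)//; last exact: ltW.
  by move=> t dt; apply: psi0; rewrite in_itv/= andbC ltNge dt.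
Qed.

Lemma test_function0 a b phi x : test_function a b phi ->
  x \notin `]a, b[ -> phi x = 0 /\ derive1 phi x = 0.
Proof.
move=> [dphi cphi sphi] xab.
have cl : (~` closure [set x | phi x != 0]) x.
  by apply: contraNnot xab => /sphi.
split.
  by apply: contra_notP cl => /eqP phix; apply: subset_closure.
rewrite derive1E (@near_eq_derive _ _ _ _ (cst 0)) ?derive_cst//.
have : nbhs x (~` closure [set x | phi x != 0]).
  by apply: open_nbhs_nbhs; split => //; by rewrite openC; exact: closed_closure.
apply: filterS => y; apply: contra_notP => /eqP phiy; exact: subset_closure.
Qed.

(** The form in which test functions enter the integrations by parts: as
    primitives of functions of zero mean. *)
Lemma test_functionE a b phi : test_function a b phi ->
  [/\ L1 (derive1 phi), phi = primitive (derive1 phi) & \int[mu]_x derive1 phi x = 0].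
Proof.
move=> tphi; have [dphi cphi sphi] := tphi.
have lphi : L1 (derive1 phi).
  apply: (@continuous_supp_L1 _ a b) => // x xab.
  by case: (test_function0 tphi xab).
have E : phi = primitive (derive1 phi).
  apply/funext => x; have [xa|ax] := leP x a.
    rewrite (@primitive_supp _ _ a)//.
      by case: (@test_function0 a b phi x) => //; rewrite in_itv/= ltNge xa.
    move=> t ta; case: (@test_function0 a b phi t) => //.
    by rewrite in_itv/= ltNge ta.
  rewrite -[RHS]subr0 -[X in _ - X](@primitive_supp _ (derive1 phi) a a)//; last first.
    move=> t ta; case: (@test_function0 a b phi t) => //.
    by rewrite in_itv/= ltNge ta.
  rewrite primitiveB//; last exact: ltW.
  rewrite Rintegral_itv_obnd_cbnd; last exact: L1S.
  rewrite /Rintegral (@continuous_FTC2 _ _ phi)//.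
  - rewrite -EFinB/= [phi a](_ : _ = 0) ?subr0//.
    by case: (@test_function0 a b phi a) => //; rewrite in_itv/= ltxx.
  - exact: continuous_subspaceT.
  - have cp : continuous phi.
      by move=> y; apply: differentiable_continuous; exact/derivable1_diffP.
    split => //.
    + by apply: cvg_at_right_filter; exact: cp.
    + by apply: cvg_at_left_filter; exact: cp.
split => //.
rewrite -(@primitive_supp_ge _ _ b b)//; last first.
  move=> t bt; case: (@test_function0 a b phi t) => //.
  by rewrite in_itv/= andbC ltNge bt.
rewrite -E; case: (@test_function0 a b phi b) => //.
by rewrite in_itv/= ltxx andbF.
Qed.
End Test_functions.

(** * The lemma of du Bois-Reymond *)

Section DuBoisReymond.
Context {R : realType}.
Implicit Types (f g h phi psi : R -> R) (a b c d x y : R).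

(** Continuous functions supported in [c, d], increasing with n to the indicator
    of ]c, d[: the positive part of a parabola, magnified and cut off at 1. *)
Definition bump c d (n : nat) x : R :=
  Num.min 1 (n%:R * Num.max 0 ((x - c) * (d - x))).

Lemma bump_continuous c d n : continuous (bump c d n).
Proof.
move=> x; rewrite /bump.
apply: (@continuous_min _ _ (cst 1) (fun x => n%:R * Num.max 0 ((x - c) * (d - x))));
  first exact: cst_continuous.
apply: (@continuousM _ _ (cst n%:R) (fun x => Num.max 0 ((x - c) * (d - x))));
  first exact: cst_continuous.
apply: (@continuous_max _ _ (cst 0) (fun x => (x - c) * (d - x)));
  first exact: cst_continuous.
apply: (@continuousM _ _ (fun x => x - c) (fun x => d - x)).
  by apply: (@continuousB _ _ _ id (cst c)) => //; exact: cst_continuous.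
by apply: (@continuousB _ _ _ (cst d) id) => //; exact: cst_continuous.
Qed.

Lemma bump_supp c d n x : c < d -> x \notin `]c, d[ -> bump c d n x = 0.
Proof.
move=> cd; rewrite in_itv/= negb_and -!leNgt => xcd.
rewrite /bump max_l ?mulr0 ?min_r ?ler01//.
by case/orP: xcd => ?; nra.
Qed.

Lemma bump_ge0 c d n x : 0 <= bump c d n x.
Proof. by rewrite /bump le_min ler01 mulr_ge0// le_max lexx. Qed.

Lemma bump_le1 c d n x : bump c d n x <= 1.
Proof. by rewrite /bump ge_min lexx. Qed.

Lemma bump_cvg c d x : c < d -> bump c d n x @[n --> \oo] --> (\1_`]c, d[ x : R).
Proof.
move=> cd; rewrite indicE; have [xcd|xcd] := boolP (x \in `]c, d[).
  rewrite mem_set//=.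
  apply: cvg_near_cst.
  move: xcd; rewrite in_itv/= => /andP[cx xd].
  have w0 : 0 < (x - c) * (d - x) by rewrite mulr_gt0 ?subr_gt0.
  near=> n.
  rewrite /bump max_r; last exact: ltW.
  rewrite min_l// -ler_pdivrMr// div1r ltW//.
  near: n; exact: nbhs_infty_gtr.
rewrite memNset//=; last exact/negP.
apply: cvg_near_cst; apply: nearW => n.
by rewrite bump_supp.
Unshelve. all: by end_near. Qed.

(** Dominated convergence along the bumps. *)
Lemma Rintegral_eq0_of_continuous h c d : c < d -> L1 h ->
  (forall psi, continuous psi -> (forall x, x \notin `]c, d[ -> psi x = 0) ->
    \int[mu]_x (h x * psi x) = 0) ->
  \int[mu]_(x in `]c, d[) h x = 0.
Proof.
move=> cd lh H.
have mh := L1_measurable lh.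
have [] := @dominated_convergence _ _ _ mu setT measurableT
  (fun n x => (h x * bump c d n x)%:E) (fun x => (h x * \1_`]c, d[ x)%:E)
  (fun x => (`|h x|)%:E).
- move=> n; apply/measurable_EFinP; apply: measurable_funM => //.
  apply: continuous_measurable_fun; exact: bump_continuous.
- by apply/measurable_EFinP; apply: measurable_funM.
- apply: aeW => x _; apply: cvg_EFin; first exact: nearW.
  by apply: cvgM; [exact: cvg_cst|exact: bump_cvg].
- exact: (integrable_norm lh).
- apply: aeW => x n _; rewrite lee_fin normrM ler_piMr//.
  by rewrite ger0_norm ?bump_ge0// bump_le1.
move=> i1 _; rewrite (_ : [sequence _]_n = cst 0%E); last first.
  apply/funext => n /=.
  have lb : L1 (fun x => h x * bump c d n x).
    apply: (@L1_bounded _ _ _ 1) => //.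
      by apply: continuous_measurable_fun; exact: bump_continuous.
    by move=> x; rewrite ger0_norm ?bump_ge0// bump_le1.
  rewrite EFin_Rintegral// H//; first exact: bump_continuous.
  by move=> x; exact: bump_supp.
move=> /cvg_lim => /(_ (@ereal_hausdorff R)).
rewrite lim_cst// => /(congr1 fine)/= /esym <-.
rewrite Rintegral_mkcond /Rintegral; congr fine; apply: eq_integral => x _.
rewrite patchE indicE; case: ifPn => xcd.
  by rewrite mulr1.
by rewrite mulr0.
Qed.

(** By the Lebesgue differentiation theorem the integrand is almost everywhere
    the derivative of its primitive. *)
Lemma ae_eq0_of_primitive_cst h a b C : L1 h ->
  {in `]a, b[, forall x, primitive h x = C} ->
  {ae @lebesgue_measure R, forall x, x \in `]a, b[ -> h x = 0}.
Proof.
move=> lh hC.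
have lloc : locally_integrable setT h.
  by apply: open_integrable_locally => //; exact: openT.
have lh' y : mu.-integrable `]-oo, y] (EFin \o h) by exact: L1S.
have := FTC1Ny lh' lloc.
apply: filterS => x [_ <-] xab.
rewrite derive1E (@near_eq_derive _ _ _ _ (cst C)) ?derive_cst//.
have : nbhs x [set` `]a, b[].
  by apply: open_nbhs_nbhs; split => //; exact: interval_open.
by apply: filterS => y /hC.
Qed.

Lemma ae_eq0_of_continuous h a b : L1 h ->
  (forall c d, a < c -> c < d -> d < b ->
   forall psi, continuous psi -> (forall x, x \notin `]c, d[ -> psi x = 0) ->
    \int[mu]_x (h x * psi x) = 0) ->
  {ae @lebesgue_measure R, forall x, x \in `]a, b[ -> h x = 0}.
Proof.
move=> lh H.
have [ab|ba] := ltP a b; last first.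
  by apply: aeW => x; rewrite in_itv/= => /andP[ax xb]; lra.
pose m := (a + b) / 2.
have [am mb] : a < m /\ m < b by rewrite midf_lt// midf_lt//.
have P x y : a < x -> x <= y -> y < b -> primitive h x = primitive h y.
  move=> ax; rewrite le_eqVlt => /predU1P[->//|xy] yb.
  apply/esym/eqP; rewrite -subr_eq0; apply/eqP.
  rewrite primitiveB//; last exact: ltW.
  rewrite -Rintegral_itv_bndo_bndc; last exact: L1S.
  by apply: Rintegral_eq0_of_continuous => //; exact: H.
apply: (@ae_eq0_of_primitive_cst _ _ _ (primitive h m)) => // x.
rewrite in_itv/= => /andP[ax xb].
have [xm|mx] := leP x m; first by exact: P.
by apply/esym/P => //; exact: ltW.
Qed.

(** Fix psi0 continuous, supported inside ]a, b[, of integral different from 0.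
    For every psi of the same kind, psi - l psi0 has zero mean for a suitable l,
    hence is the derivative of a test function. Testing h with it shows that
    h - C, with C = int h psi0 / int psi0, is orthogonal to psi. *)
Lemma duBoisReymond h a b : a < b -> L1 h ->
  (forall phi, test_function a b phi -> \int[mu]_x (h x * derive1 phi x) = 0) ->
  exists C, {ae @lebesgue_measure R, forall x, x \in `]a, b[ -> h x = C}.
Proof.
move=> ab lh H.
pose c0 := a + (b - a) / 3; pose d0 := a + (b - a) / 3 * 2.
have [ac0 cd0 d0b] : [/\ a < c0, c0 < d0 & d0 < b] by split; rewrite /c0 /d0; lra.
pose one : R -> R := \1_`]a, b[.
have l1 : L1 one by exact: integrable_indic_itv.
have oneM psi c d : a < c -> d < b -> (forall x, x \notin `]c, d[ -> psi x = 0) ->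
    forall x, one x * psi x = psi x.
  move=> ac db psi0 x; rewrite /one indicE.
  have [xab|xab] := boolP (x \in `]a, b[); first by rewrite mem_set// mul1r.
  rewrite memNset; last exact/negP.
  rewrite psi0 ?mulr0//; apply: contraNN xab; rewrite !in_itv/= => /andP[cx xd].
  by rewrite (lt_trans ac)//= (lt_trans xd).
(* If all such integrals were 0, then so would be the length of ]c0, d0[. *)
have [psi0 [cpsi0 spsi0 Ipsi0]] : exists psi, [/\ continuous psi,
    (forall x, x \notin `]c0, d0[ -> psi x = 0) & \int[mu]_x psi x != 0].
  apply: contrapT => N.
  have : \int[mu]_(x in `]c0, d0[) one x = 0.
    apply: Rintegral_eq0_of_continuous => // psi cpsi spsi.
    under eq_Rintegral do rewrite (oneM _ c0 d0)//.
    by apply: contra_notP N => /eqP; exists psi.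
  rewrite (@eq_Rintegral _ _ _ _ _ (cst 1)); last first.
    move=> x; rewrite inE/= in_itv/= => /andP[cx xd].
    rewrite /one indicE mem_set//= in_itv/=.
    by rewrite (lt_trans ac0)//= (lt_trans xd).
  rewrite Rintegral_cst// mul1r.
  move=> /(etrans (esym (congr1 fine (@lebesgue_measure_itv R `]c0, d0[)))).
  rewrite /= lte_fin cd0/=.
  by move=> /eqP; rewrite subr_eq0 => /eqP E; move: cd0; rewrite E ltxx.
have lpsi0 := continuous_supp_L1 cpsi0 spsi0.
have bcont psi c d : continuous psi -> (forall x, x \notin `]c, d[ -> psi x = 0) ->
   forall f, L1 f -> L1 (fun x => f x * psi x).
  move=> cpsi spsi f lf.
  have [M psiM] := continuous_supp_bounded cpsi spsi.
  apply: (@L1_bounded _ _ _ M) => //; exact: continuous_measurable_fun.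
pose C := (\int[mu]_x (h x * psi0 x)) / \int[mu]_x psi0 x.
exists C.
have lhC : L1 (fun x => h x - C * one x) by apply: L1B => //; exact: L1Z.
suff : {ae @lebesgue_measure R, forall x, x \in `]a, b[ -> h x - C * one x = 0}.
  apply: filterS => x + xab => /(_ xab)/eqP.
  by rewrite /one indicE mem_set// mulr1 subr_eq0 => /eqP.
apply: ae_eq0_of_continuous => // c d ac cd db psi cpsi spsi.
have lpsi := continuous_supp_L1 cpsi spsi.
pose l := (\int[mu]_x psi x) / \int[mu]_x psi0 x.
pose chi x := psi x - l * psi0 x.
have cchi : continuous chi.
  move=> x; apply: (@continuousB _ _ _ psi (fun x => l * psi0 x)); first exact: cpsi.
  by apply: (@continuousM _ _ (cst l) psi0); [exact: cst_continuous|exact: cpsi0].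
(* The smallest interval containing the supports of psi and psi0. *)
have schi x : x \notin `]Num.min c c0, Num.max d d0[ -> chi x = 0.
  rewrite in_itv/= => N; rewrite /chi spsi ?spsi0 ?mulr0 ?subr0//; apply: contraNN N;
    rewrite in_itv/= => /andP[N1 N2]; rewrite gt_min lt_max N1 N2 ?orbT//.
have Ichi : \int[mu]_x chi x = 0.
  rewrite /chi RintegralB//; last exact: L1Z.
  by rewrite RintegralZl// /l divfK// subrr.
have tchi : test_function a b (primitive chi).
  apply: (primitive_test_function _ _ cchi schi Ichi).
    by rewrite lt_min ac ac0.
  by rewrite gt_max db d0b.
have dchi x : derive1 (primitive chi) x = chi x.
  by case: (primitive_derive x cchi schi).
have lhpsi := bcont _ _ _ cpsi spsi _ lh.
have lhpsi0 := bcont _ _ _ cpsi0 spsi0 _ lh.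
have : \int[mu]_x (h x * psi x - l * (h x * psi0 x)) = 0.
  rewrite -[RHS](H _ tchi); apply: eq_Rintegral => x _.
  by rewrite dchi /chi; ring.
rewrite RintegralB//; last exact: L1Z.
rewrite RintegralZl// => E.
transitivity (\int[mu]_x (h x * psi x - C * psi x)).
  by apply: eq_Rintegral => x _; rewrite mulrBl -mulrA (oneM _ c d).
rewrite RintegralB//; last exact: L1Z.
rewrite RintegralZl// -E /l /C; congr (_ - _).
by rewrite mulrC mulrA mulrAC.
Qed.
End DuBoisReymond.

(** * Square integrable functions on an interval *)

Section Lp_spaces.
Context {R : realType}.
Implicit Types (f g h u : R -> R) (a b c d x y : R).

(** Domination is only required almost everywhere, because the coefficients of
    the form are bounded only in that sense. *)
Lemma le_L1_ae f g : L1 g -> measurable_fun setT f ->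
  {ae @lebesgue_measure R, forall x, `|f x| <= g x} -> L1 f.
Proof.
move=> lg mf fg; apply/integrableP; split; first exact/measurable_EFinP.
have /integrableP[_] := integrable_norm lg.
apply: le_lt_trans; apply: ae_ge0_le_integral => //.
- by do 2 apply: measurableT_comp => //.
- do 3 apply: measurableT_comp => //; exact: L1_measurable.
- by apply: filterS fg => x fgx _ /=; rewrite lee_fin normr_id (le_trans fgx)// ler_norm.
Qed.

Lemma Lp_measurable p a b f : Lp p a b f -> measurable_fun setT (f \_ `]a, b[).
Proof. by rewrite /Lp inE => /andP[]; rewrite inE. Qed.

Lemma Lp2P a b f : measurable_fun setT (f \_ `]a, b[) ->
  L1 (fun x => (f \_ `]a, b[) x ^+ 2) -> Lp 2%:E a b f.
Proof.
move=> mf /integrableP[_ l2]; rewrite /Lp inE; apply/andP; split; rewrite inE//=.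
rewrite /finite_norm unlock /Lnorm poweR_lty//; apply: le_lt_trans l2.
apply: ge0_le_integral => //=.
- apply/measurable_EFinP.
  apply: (@measurableT_comp _ _ _ _ _ _ (fun x : R => x `^ 2)) => //.
  exact: measurableT_comp.
- do 2 apply: measurableT_comp => //; exact: measurable_funX.
- by move=> x _; rewrite lee_fin normrX powR_mulrn.
Qed.

Lemma Lp2_mul a b f g : Lp 2%:E a b f -> Lp 2%:E a b g ->
  L1 ((fun x => f x * g x) \_ `]a, b[).
Proof.
move=> lf lg; have /Lfun1_integrable := Lfun2_mul_Lfun1 lf lg.
congr (integrable mu setT _); apply/funext => x /=.
by rewrite !patchE; case: ifP => //; rewrite mulr0.
Qed.

Lemma Lp2_bounded a b f M : measurable_fun setT (f \_ `]a, b[) ->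
  {ae @lebesgue_measure R, forall x, x \in `]a, b[ -> `|f x| <= M} ->
  Lp 2%:E a b f.
Proof.
move=> mf fM; apply: Lp2P => //.
apply: (@le_L1_ae _ (fun x => M ^+ 2 * \1_`]a, b[ x)).
- by apply: L1Z; exact: integrable_indic_itv.
- exact: measurable_funX.
apply: filterS fM => x fM; rewrite patchE indicE; case: ifPn => xab.
  rewrite mulr1 normrX; apply: lerXn2r; rewrite ?nnegrE//.
    by rewrite (le_trans (normr_ge0 (f x)))// fM//; rewrite inE in xab.
  by apply: fM; rewrite inE in xab.
by rewrite expr0n normr0 mulr0.
Qed.

Lemma Lp2_cst1 a b : Lp 2%:E a b (cst 1).
Proof.
apply: (@Lp2_bounded _ _ _ 1).
  by apply/(measurable_restrictT _ _).1.
by apply: aeW => x _; rewrite normr1.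
Qed.

Lemma Lp2_L1 a b f : Lp 2%:E a b f -> L1 (f \_ `]a, b[).
Proof.
move=> /Lp2_mul /(_ (Lp2_cst1 a b)); congr (integrable mu setT _).
by apply/funext => x; rewrite /= !patchE mulr1.
Qed.

Lemma Lp2D a b f g : Lp 2%:E a b f -> Lp 2%:E a b g ->
  Lp 2%:E a b (fun x => f x + g x).
Proof.
move=> lf lg; rewrite /Lp (_ : _ \_ _ = (f \_ `]a, b[) + (g \_ `]a, b[)).
  exact: (Lfun_addr_closed _ (lee1n 2)).2.
by apply/funext => x; rewrite fctE !patchE; case: ifP; rewrite ?addr0.
Qed.

Lemma Lp2_mul_bounded a b f g M : Lp 2%:E a b f ->
  measurable_fun setT (g \_ `]a, b[) ->
  {ae @lebesgue_measure R, forall x, x \in `]a, b[ -> `|g x| <= M} ->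
  Lp 2%:E a b (fun x => g x * f x).
Proof.
move=> lf mg gM.
have E : (fun x => g x * f x) \_ `]a, b[ =
         (fun x => (g \_ `]a, b[) x * (f \_ `]a, b[) x).
  by apply/funext => x; rewrite !patchE; case: ifP; rewrite ?mulr0.
have mf := Lp_measurable lf.
apply: Lp2P; rewrite E; first exact: measurable_funM.
apply: (@le_L1_ae _ (fun x => M ^+ 2 * ((fun x => f x * f x) \_ `]a, b[) x)).
- by apply: L1Z; exact: Lp2_mul.
- by apply: measurable_funX; exact: measurable_funM.
apply: filterS gM => x gM; rewrite !patchE; case: ifPn => xab; last first.
  by rewrite mulr0 expr0n normr0 mulr0.
rewrite inE in xab.
rewrite normrX normrM exprMn -expr2 -[leRHS]/(M ^+ 2 * f x ^+ 2).
rewrite real_normK ?num_real// [X in _ * X <= _]real_normK ?num_real// ler_wpM2r ?sqr_ge0//.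
rewrite -[leLHS]real_normK ?num_real//.
apply: lerXn2r; rewrite ?nnegrE//; last exact: gM.
by rewrite (le_trans (normr_ge0 (g x)))// gM.
Qed.

Lemma Lp2Z a b c f : Lp 2%:E a b f -> Lp 2%:E a b (fun x => c * f x).
Proof.
move=> lf; apply: (@Lp2_mul_bounded _ _ _ (cst c) `|c|) => //.
- by apply/(measurable_restrictT _ _).1.
- exact: aeW.
Qed.

Lemma Lp2_sum a b (I : Type) (s : seq I) (F : I -> R -> R) :
  (forall i, Lp 2%:E a b (F i)) -> Lp 2%:E a b (fun x => \sum_(i <- s) F i x).
Proof.
move=> lF; elim: s => [|i s IH].
  under eq_fun do rewrite big_nil.
  rewrite (_ : (fun=> 0) = (fun x => 0 * cst 1 x)); first exact/Lp2Z/Lp2_cst1.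
  by apply/funext => x; rewrite mul0r.
by under eq_fun do rewrite big_cons; exact: Lp2D.
Qed.
End Lp_spaces.

(** * H^1 functions as primitives of square integrable functions *)

Section H1_primitives.
Context {R : realType}.
Implicit Types (f g h u v k : R -> R) (a b c d x y : R).

(** The description of H^1(a, b) with which the rest works: g is a square
    integrable density whose integral recovers u from its value at a. In this
    form restricting, gluing and adding functions are computations with
    integrals. *)
Definition L2_primitive a b u g : Prop :=
  Lp 2%:E a b g /\
  {in `[a, b], forall x, u x = u a + primitive (g \_ `]a, b[) x}.

Lemma primitive_left a b g : primitive (g \_ `]a, b[) a = 0.
Proof.
apply: (@primitive_supp _ _ a) => // t ta; rewrite patchE memNset//= in_itv/=.
by rewrite ltNge ta.
Qed.

(** The derivative of a test function has zero mean, so that the product of total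
    masses in the integration by parts for primitives is zero. *)
Lemma weak_derivative_primitive a b C u g : L1 (g \_ `]a, b[) ->
  {in `]a, b[, forall x, u x = C + primitive (g \_ `]a, b[) x} ->
  is_weak_derivative a b u g.
Proof.
move=> lg uE phi tphi.
have [ldphi phiE Idphi] := test_functionE tphi.
have := primitive_by_parts lg ldphi.
rewrite -phiE Idphi mulr0 => BP.
transitivity (\int[mu]_x (C * derive1 phi x + primitive (g \_ `]a, b[) x * derive1 phi x)).
  rewrite Rintegral_mkcond; apply: eq_Rintegral => x _.
  rewrite patchE; case: ifPn => xab.
    by rewrite uE ?mulrDl//; rewrite inE in xab.
  have {}xab : x \notin `]a, b[ by apply/negP; rewrite notin_setE in xab.
  by have [_ ->] := test_function0 tphi xab; rewrite !mulr0 addr0.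
rewrite RintegralD//; last 2 first.
- exact: L1Z.
- have := L1_mul_primitive ldphi lg.
  by under eq_fun do rewrite mulrC.
rewrite RintegralZl// Idphi mulr0 add0r.
apply/eqP; rewrite -addr_eq0 -[X in _ == X]BP; apply/eqP; congr (_ + _).
rewrite Rintegral_mkcond; apply: eq_Rintegral => x _.
by rewrite !patchE; case: ifP => //; rewrite mul0r.
Qed.

(** A nonempty open interval has positive length. *)
Lemma ae_exists (P : R -> Prop) a b : a < b ->
  {ae @lebesgue_measure R, forall x, P x} -> exists2 x, x \in `]a, b[ & P x.
Proof.
move=> ab [N [mN N0 PN]]; apply: contrapT => H.
have abN : [set` `]a, b[] `<=` N.
  by move=> x xab; apply: PN => Px; apply: H; exists x.
have K z : @lebesgue_measure R [set` `]a, b[] = z -> (z <= 0)%E.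
  by move=> <-; rewrite -N0; apply: le_measure => //; rewrite inE.
have := K _ (@lebesgue_measure_itv R `]a, b[).
by rewrite /= lte_fin ab -EFinB lee_fin subr_le0 leNgt ab.
Qed.

(** Points where k takes the value C are dense in [a, b]; this includes the
    endpoints, where continuity within [a, b] is what matters. *)
Lemma continuous_ae_cst a b k C : a < b -> {within `[a, b], continuous k} ->
  {ae @lebesgue_measure R, forall x, x \in `]a, b[ -> k x = C} ->
  {in `[a, b], forall x, k x = C}.
Proof.
move=> ab /subspace_continuousP ck kC x xab.
apply/eqP; rewrite -subr_eq0 -normr_le0; apply/ler_addgt0Pr => e e0; rewrite add0r.
have /cvgrPdist_le/(_ _ e0) := ck _ xab.
rewrite near_withinE => -[d /= d0 kd].
have pq : Num.max a (x - d) < Num.min b (x + d).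
  by move: xab; rewrite in_itv/= lt_min !gt_max => /andP[? ?]; lra.
have [y] := ae_exists pq kC.
rewrite in_itv/= gt_max lt_min => /andP[/andP[ay xy] /andP[yb yx]] <-.
  apply: kd; rewrite /= ?in_itv/= ?ltW//.
  by rewrite ltr_distl; lra.
by rewrite in_itv/= ay.
Qed.

(** The function u and the primitive of g have the same weak derivative, so their
    difference is almost everywhere constant by du Bois-Reymond, and everywhere
    constant on [a, b] by continuity. *)
Lemma weak_derivative_L2_primitive a b u g : a < b -> {within `[a, b], continuous u} ->
  Lp 2%:E a b u -> Lp 2%:E a b g -> is_weak_derivative a b u g -> L2_primitive a b u g.
Proof.
move=> ab cu lu lg wd; split => //.
have l1g := Lp2_L1 lg.
set P := primitive (g \_ `]a, b[).
pose h := (fun x => u x - P x) \_ `]a, b[.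
have lP : L1 (P \_ `]a, b[).
  apply/Lp2_L1; apply: (@Lp2_bounded _ _ _ _ (\int[mu]_x `|(g \_ `]a, b[) x|)).
    by apply/(measurable_restrictT _ _).1 => //; apply: measurable_funTS; exact: primitive_measurable.
  by apply: aeW => x _; exact: primitive_bounded.
have hE : h = (fun x => (u \_ `]a, b[) x - (P \_ `]a, b[) x).
  by apply/funext => x; rewrite /h !patchE; case: ifP; rewrite ?subrr.
have lh : L1 h by rewrite hE; apply: L1B => //; exact: Lp2_L1.
have [phi tphi|C hC] := duBoisReymond ab lh.
  have [ldphi _ _] := test_functionE tphi.
  have wP : is_weak_derivative a b P g.
    by apply: (@weak_derivative_primitive _ _ 0) => // x _; rewrite add0r.
  have := wd _ tphi; rewrite -(wP _ tphi) => E.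
  have [M Mphi] : exists M, forall x, `|derive1 phi x| <= M.
    have [_ cphi _] := tphi; apply: (@continuous_supp_bounded _ _ a b) => // x.
    by case/(test_function0 tphi).
  have L f : L1 (f \_ `]a, b[) ->
      mu.-integrable `]a, b[ (EFin \o (fun x => f x * derive1 phi x)).
    move=> lf; apply/(L1_restrict _ _).2 => //.
    rewrite (_ : _ \_ _ = (fun x => (f \_ `]a, b[) x * derive1 phi x)).
      exact: (@L1_bounded _ _ _ M lf (L1_measurable ldphi)).
    by apply/funext => x; rewrite !patchE; case: ifP; rewrite ?mul0r.
  rewrite -[RHS](subrr (\int[mu]_(x in `]a, b[) (P x * derive1 phi x))) -[X in X - _]E.
  rewrite -RintegralB//; [|exact/L/Lp2_L1|exact/L].
  rewrite [RHS]Rintegral_mkcond; apply: eq_Rintegral => x _.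
  by rewrite /h !patchE; case: ifP; rewrite ?mul0r// mulrBl.
have kC : {in `[a, b], forall x, u x - P x = C}.
  apply: continuous_ae_cst => //.
    move=> x; apply: continuousB; first exact: cu.
    by apply: continuous_subspaceT => //; exact: primitive_continuous.
  apply: filterS hC => x hx xab; rewrite -[RHS]hx// /h patchE mem_set//.
move=> x xab; have := kC _ xab; rewrite -(kC a); last by rewrite in_itv/= lexx ltW.
by rewrite /P primitive_left subr0 => /eqP; rewrite subr_eq => /eqP.
Qed.

Lemma wderiv_L2_primitive a b u : a < b -> H1 a b u -> L2_primitive a b u (wderiv a b u).
Proof.
move=> ab [cu lu [g lg wg]].
have [lw ww] : (Lp 2%:E a b `&` is_weak_derivative a b u) (wderiv a b u).
  by rewrite /wderiv; apply: (@xgetPex _ (cst 0)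
    [set g | Lp 2%:E a b g /\ is_weak_derivative a b u g]); exists g.
exact: weak_derivative_L2_primitive.
Qed.

Lemma L2_primitive_H1 a b u g : a <= b -> L2_primitive a b u g -> H1 a b u.
Proof.
move=> ab [lg uE]; have l1g := Lp2_L1 lg.
pose w x := u a + primitive (g \_ `]a, b[) x.
have cw : continuous w.
  move=> x; apply: (@continuousD _ _ _ (cst (u a)) (primitive _)).
    exact: cst_continuous.
  exact: primitive_continuous.
split.
- apply: (@subspace_eq_continuous _ _ _ w); last exact: continuous_subspaceT.
  by move=> x; rewrite inE => xab; exact/esym/uE.
- rewrite /Lp (_ : u \_ _ = w \_ `]a, b[); last first.
    apply/funext => x; rewrite !patchE; case: ifPn => //; rewrite inE => xab.
    by apply: uE; exact: subset_itv_oo_cc.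
  apply: (@Lp2_bounded _ _ _ _ (`|u a| + \int[mu]_x `|(g \_ `]a, b[) x|)).
    apply/(measurable_restrictT _ _).1 => //; apply: measurable_funTS.
    exact: continuous_measurable_fun.
  apply: aeW => x _; rewrite (le_trans (ler_normD _ _))// lerD2l.
  exact: primitive_bounded.
- exists g => //; apply: (@weak_derivative_primitive _ _ (u a)) => //.
  by move=> x xab; apply: uE; exact: subset_itv_oo_cc.
Qed.

(** Two densities of the same function have equal primitives on ]a, b[, hence
    agree at almost every point of it. *)
Lemma L2_primitive_ae_unique a b u g h : a < b -> L2_primitive a b u g -> L2_primitive a b u h ->
  {ae @lebesgue_measure R, forall x, x \in `]a, b[ -> g x = h x}.
Proof.
move=> ab [lg ug] [lh uh].
have l1g := Lp2_L1 lg; have l1h := Lp2_L1 lh.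
suff : {ae @lebesgue_measure R, forall x, x \in `]a, b[ ->
    (g \_ `]a, b[) x - (h \_ `]a, b[) x = 0}.
  apply: filterS => x + xab => /(_ xab)/eqP.
  by rewrite !patchE mem_set// subr_eq0 => /eqP.
apply: (@ae_eq0_of_primitive_cst _ _ _ _ 0); first exact: L1B.
move=> x xab.
have l1Nh : L1 (fun x => -1 * (h \_ `]a, b[) x) by exact: L1Z.
under [X in primitive X _]eq_fun do rewrite -mulN1r.
rewrite primitiveD// primitiveZ// mulN1r; apply/eqP; rewrite subr_eq0.
have xcc : x \in `[a, b] by exact: subset_itv_oo_cc.
by apply/eqP/(addrI (u a)); rewrite -(ug _ xcc) -(uh _ xcc).
Qed.

(** The chosen weak derivative may thus be replaced under integrals by any density
    at hand. *)
Lemma wderivE a b u g : a < b -> L2_primitive a b u g ->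
  {ae @lebesgue_measure R, forall x, x \in `]a, b[ -> wderiv a b u x = g x}.
Proof.
move=> ab ug; apply: (L2_primitive_ae_unique ab _ ug).
by apply: wderiv_L2_primitive => //; apply: L2_primitive_H1 ug; exact: ltW.
Qed.
End H1_primitives.

(** * Operations on H^1 functions *)

Section H1_operations.
Context {R : realType}.
Implicit Types (f g h u v k : R -> R) (a b c d x y : R).

Lemma subset_itv_oo a b c d : a <= c -> d <= b ->
  [set` `]c, d[] `<=` [set` `]a, b[].
Proof.
move=> ac db t /=; rewrite !in_itv/= => /andP[ct td].
by rewrite (le_lt_trans ac)//= (lt_le_trans td).
Qed.

Lemma restrict_restrict f (D E : set R) : E `<=` D ->
  (f \_ D) \_ E = f \_ E.
Proof.
move=> ED; apply/funext => t; rewrite !patchE; case: ifPn => // tE.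
by rewrite mem_set//; apply: ED; rewrite inE in tE.
Qed.

Lemma restrict_restrict_super f (D E : set R) : E `<=` D ->
  (f \_ E) \_ D = f \_ E.
Proof.
move=> ED; apply/funext => t; rewrite !patchE; case: ifPn => // tD.
by rewrite memNset// => /ED tD'; move: tD; rewrite notin_setE.
Qed.

Lemma primitive_restrict_itv f a b c d x : L1 (f \_ `]a, b[) ->
  a <= c -> d <= b -> c <= x -> x <= d ->
  primitive (f \_ `]c, d[) x =
  primitive (f \_ `]a, b[) x - primitive (f \_ `]a, b[) c.
Proof.
move=> lf ac db cx xd.
have sub := subset_itv_oo ac db.
have E := esym (restrict_restrict f sub).
have lcd : L1 (f \_ `]c, d[).
  by rewrite E; apply/(L1_restrict _ _).1 => //; exact: L1S.
rewrite -[LHS]subr0 -[X in _ - X](primitive_left c d f) !primitiveB//.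
rewrite -Rintegral_itv_bndo_bndc; last exact: L1S.
rewrite -[RHS]Rintegral_itv_bndo_bndc; last exact: L1S.
apply: eq_Rintegral => t; rewrite inE/= in_itv/= => /andP[ct tx].
have tcd : t \in `]c, d[ by rewrite in_itv/= ct (lt_le_trans tx).
by rewrite !patchE !mem_set//; exact: sub.
Qed.

Lemma Lp2S f a b c d : a <= c -> d <= b -> Lp 2%:E a b f -> Lp 2%:E c d f.
Proof.
move=> ac db lf.
have sub := subset_itv_oo ac db.
have E := esym (restrict_restrict f sub).
have mf := Lp_measurable lf.
have mcd : measurable_fun setT (f \_ `]c, d[).
  by rewrite E; apply/(measurable_restrictT _ _).1 => //; exact: measurable_funTS.
apply: Lp2P => //.
apply: (le_L1_ae (Lp2_mul lf lf)); first exact: measurable_funX.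
apply: aeW => x; rewrite E !patchE; case: ifPn => xcd.
  rewrite inE in xcd.
  by rewrite mem_set; [rewrite ger0_norm ?sqr_ge0// expr2|exact: sub].
by rewrite expr0n normr0; case: ifP => // _; rewrite -expr2 sqr_ge0.
Qed.

Lemma eq_L2_primitive a b u v g : a <= b -> {in `[a, b], u =1 v} ->
  L2_primitive a b u g -> L2_primitive a b v g.
Proof.
move=> ab uv [lg ug]; split => // x xab.
by rewrite -!uv//; [exact: ug|rewrite in_itv/= lexx ab].
Qed.

Lemma L2_primitiveD a b u v g h : L2_primitive a b u g -> L2_primitive a b v h ->
  L2_primitive a b (fun x => u x + v x) (fun x => g x + h x).
Proof.
move=> [lg ug] [lh vh]; split; first exact: Lp2D.
move=> x xab; rewrite (ug _ xab) (vh _ xab) addrACA -primitiveD; [|exact: Lp2_L1..].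
congr (_ + primitive _ x); apply/funext => t.
by rewrite !patchE; case: ifP => //; rewrite addr0.
Qed.

Lemma L2_primitiveZ a b c u g : L2_primitive a b u g ->
  L2_primitive a b (fun x => c * u x) (fun x => c * g x).
Proof.
move=> [lg ug]; split; first exact: Lp2Z.
move=> x xab; rewrite (ug _ xab) mulrDr -primitiveZ; last exact: Lp2_L1.
congr (_ + primitive _ x); apply/funext => t.
by rewrite !patchE; case: ifP => //; rewrite mulr0.
Qed.

Lemma L2_primitiveB a b u v g h : L2_primitive a b u g -> L2_primitive a b v h ->
  L2_primitive a b (fun x => u x - v x) (fun x => g x - h x).
Proof.
move=> ug /(L2_primitiveZ (-1)) /(L2_primitiveD ug).
by under eq_fun do rewrite mulN1r; under [X in L2_primitive _ _ _ X]eq_fun do rewrite mulN1r.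
Qed.

Lemma L2_primitive_sum a b (I : Type) (s : seq I) (c : I -> R) (F G : I -> R -> R) :
  (forall i, L2_primitive a b (F i) (G i)) ->
  L2_primitive a b (fun x => \sum_(i <- s) c i * F i x)
             (fun x => \sum_(i <- s) c i * G i x).
Proof.
move=> FG; elim: s => [|i s IH].
  under eq_fun do rewrite big_nil; under [X in L2_primitive _ _ _ X]eq_fun do rewrite big_nil.
  split.
    rewrite (_ : (fun=> 0) = (fun x => 0 * cst 1 x)); first exact/Lp2Z/Lp2_cst1.
    by apply/funext => x; rewrite mul0r.
  move=> x _; rewrite add0r; apply/esym; apply: (@primitive_supp _ _ x) => //.
  by move=> t _; rewrite patchE; case: ifP.
under eq_fun do rewrite big_cons; under [X in L2_primitive _ _ _ X]eq_fun do rewrite big_cons.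
by apply: L2_primitiveD => //; exact: L2_primitiveZ.
Qed.

Lemma L2_primitiveS a b c d u g : a <= c -> d <= b -> L2_primitive a b u g ->
  L2_primitive c d u g.
Proof.
move=> ac db [lg ug]; split; first exact: Lp2S lg.
move=> x; rewrite in_itv/= => /andP[cx xd].
have l1 := Lp2_L1 lg.
have xab : x \in `[a, b] by rewrite in_itv/= (le_trans ac)//= (le_trans xd).
have cab : c \in `[a, b] by rewrite in_itv/= ac (le_trans cx)// (le_trans xd).
by rewrite (primitive_restrict_itv l1 ac)// (ug _ xab) (ug _ cab) -addrA subrKC.
Qed.

(** Extension by zero keeps a bubble in H^1 because its density has zero mean: the
    primitive of the extended density vanishes on both sides of [c, d]. *)
Lemma L2_primitive_ext0 a b c d u g : a <= c -> c <= d -> d <= b ->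
  L2_primitive c d u g -> u c = 0 -> u d = 0 ->
  L2_primitive a b (u \_ `[c, d]) (g \_ `]c, d[).
Proof.
move=> ac cd db [lg ug] uc ud.
have sub := subset_itv_oo ac db.
have E := restrict_restrict_super g sub.
have l1 := Lp2_L1 lg.
have u0 x : x <= c -> (u \_ `[c, d]) x = 0.
  rewrite le_eqVlt => /predU1P[->|xc]; rewrite patchE; case: ifPn => //.
  by rewrite inE/= in_itv/= leNgt xc.
split; first by rewrite /Lp E.
move=> x xab; rewrite E (u0 a ac) add0r.
have [xc|cx] := leP x c.
  rewrite u0// (@primitive_supp _ _ c)// => t tc.
  by rewrite patchE memNset//= in_itv/= ltNge tc.
have [xd|dx] := leP x d.
  by rewrite patchE mem_set/= ?in_itv/= ?(ltW cx)// ug ?uc ?add0r// in_itv/= (ltW cx).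
have H t : d <= t -> (g \_ `]c, d[) t = 0.
  by move=> dt; rewrite patchE memNset//= in_itv/= andbC ltNge dt.
rewrite patchE memNset/= ?in_itv/=; last by rewrite andbC leNgt dx.
rewrite (primitive_supp_ge l1 H); last exact: ltW.
by rewrite -(primitive_supp_ge l1 H (lexx d)) -[RHS]add0r -uc -ug ?ud// in_itv/= cd lexx.
Qed.
End H1_operations.

(** * The bilinear form as a pairing of the flux with the derivative *)

Section Advection_form.
Context {R : realType}.
Implicit Types (A b f g h u v k : R -> R) (a c d x y C : R).

(** The L^oo norm is an essential supremum only when the whole space has positive
    measure, which has to be checked for the line. *)
Lemma Lp_oo_bounded a c f : Lp +oo%E a c f ->
  exists M, {ae @lebesgue_measure R, forall x, x \in `]a, c[ -> `|f x| <= M}.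
Proof.
rewrite /Lp inE => /andP[_]; rewrite inE/= /finite_norm unlock /Lnorm.
case: ifPn => [_|].
  move=> /ess_supr_bounded[M fM]; exists M; apply: filterS fM => x /= fM xac.
  by move: fM; rewrite patchE mem_set.
rewrite -leNgt => le0 _; exfalso.
have K z : @lebesgue_measure R [set` `]0, 1[] = z -> (z <= 0)%E.
  by move=> <-; apply: le_trans le0; apply: le_measure => //; rewrite inE.
have := K _ (@lebesgue_measure_itv R `]0, 1[).
by rewrite /= lte_fin ltr01 sube0 lee_fin ler10.
Qed.

Lemma divergence_free_cst b : Lp +oo%E 0 1 b -> divergence_free b ->
  exists C, {ae @lebesgue_measure R, forall x, x \in `]0, 1[ -> b x = C}.
Proof.
move=> lb db; have [M bM] := Lp_oo_bounded lb.
have lb2 := Lp2_bounded (Lp_measurable lb) bM.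
have [phi tphi|C bC] := duBoisReymond ltr01 (Lp2_L1 lb2).
  have := db _ tphi; rewrite [RHS](_ : _ = 0); last first.
    rewrite (@eq_Rintegral _ _ _ _ _ (cst 0)); last by move=> x _; rewrite mul0r.
    by rewrite Rintegral_cst// mul0r oppr0.
  rewrite Rintegral_mkcond => E; rewrite -[RHS]E; apply: eq_Rintegral => x _.
  by rewrite !patchE; case: ifP; rewrite ?mul0r.
exists C; apply: filterS bC => x + xab => /(_ xab).
by rewrite patchE mem_set.
Qed.

Lemma Lp2_integrable f g a c : Lp 2%:E a c f -> Lp 2%:E a c g ->
  mu.-integrable `]a, c[ (EFin \o (fun x => f x * g x)).
Proof. by move=> lf lg; apply/(L1_restrict _ _).2 => //; exact: Lp2_mul. Qed.

Lemma Rintegral_L2D f g h a c : Lp 2%:E a c f -> Lp 2%:E a c g -> Lp 2%:E a c h ->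
  \int[mu]_(x in `]a, c[) (f x * (g x + h x)) =
  \int[mu]_(x in `]a, c[) (f x * g x) + \int[mu]_(x in `]a, c[) (f x * h x).
Proof.
move=> lf lg lh; rewrite -RintegralD//; last 2 first.
- exact: Lp2_integrable.
- exact: Lp2_integrable.
by apply: eq_Rintegral => x _; rewrite mulrDr.
Qed.

Lemma L2_primitive_Lp2 a c u g : a <= c -> L2_primitive a c u g -> Lp 2%:E a c u.
Proof. by move=> ac /L2_primitive_H1; case. Qed.

Lemma integrable_measurable (D : set R) f :
  mu.-integrable D (EFin \o f) -> measurable_fun D f.
Proof. by move=> /measurable_int /measurable_EFinP. Qed.

(** Minus the divergence of the flux A u' - C u is the operator applied to u; here
    g stands for u' and C for the constant advection field. *)
Definition flux A C u g x : R := A x * g x - C * u x.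

(** Since v vanishes at both ends its density has zero mean; this removes the
    product of total masses as well as the contribution of the constant u(0). *)
Lemma H1_by_parts u v g h : L2_primitive 0 1 u g -> L2_primitive 0 1 v h ->
  v 0 = 0 -> v 1 = 0 ->
  \int[mu]_(x in `]0, 1[) (g x * v x) = - \int[mu]_(x in `]0, 1[) (u x * h x).
Proof.
move=> ug vh v0 v1; have [lg uE] := ug; have [lh vE] := vh.
have lu := L2_primitive_Lp2 ler01 ug; have lv := L2_primitive_Lp2 ler01 vh.
have l1g := Lp2_L1 lg; have l1h := Lp2_L1 lh.
have Ih : \int[mu]_x ((h \_ `]0, 1[) x) = 0.
  rewrite -(@primitive_supp_ge _ _ 1 1)//; last first.
    by move=> t t1; rewrite patchE memNset//= in_itv/= andbC ltNge t1.
  by have := vE 1; rewrite v0 v1 add0r => <-//; rewrite in_itv/= ler01 lexx.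
have := primitive_by_parts l1g l1h; rewrite Ih mulr0.
rewrite [X in X + _](_ : _ = \int[mu]_(x in `]0, 1[) (u x * h x)); last first.
  transitivity (\int[mu]_(x in `]0, 1[) (u x * h x) - \int[mu]_(x in `]0, 1[) (u 0 * h x)).
    rewrite -RintegralB//; last 2 first.
    - exact: Lp2_integrable.
    - by apply: Lp2_integrable => //; have := Lp2Z (u 0) (Lp2_cst1 0 1); under eq_fun do rewrite /= mulr1.
    rewrite [RHS]Rintegral_mkcond; apply: eq_Rintegral => x _.
    rewrite !patchE; case: ifPn; last by rewrite mulr0.
    rewrite inE => x01; rewrite [u x]uE; last exact: subset_itv_oo_cc.
    by rewrite -mulrBl addrC addKr.
  rewrite RintegralZl//; last by apply/(L1_restrict _ _).2.
  by rewrite [X in _ - _ * X]Rintegral_mkcond Ih mulr0 subr0.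
rewrite [X in _ + X](_ : _ = \int[mu]_(x in `]0, 1[) (g x * v x)); last first.
  rewrite [RHS]Rintegral_mkcond; apply: eq_Rintegral => x _.
  rewrite !patchE; case: ifPn; last by rewrite mul0r.
  rewrite inE => x01; rewrite [v x]vE ?v0 ?add0r//; exact: subset_itv_oo_cc.
by move=> /eqP; rewrite addrC addr_eq0 => /eqP.
Qed.

Lemma flux_Lp2 A C M u g : measurable_fun setT (A \_ `]0, 1[) ->
  {ae @lebesgue_measure R, forall x, x \in `]0, 1[ -> `|A x| <= M} ->
  L2_primitive 0 1 u g -> Lp 2%:E 0 1 (flux A C u g).
Proof.
move=> mA AM ug; have lu := L2_primitive_Lp2 ler01 ug.
have := Lp2D (Lp2_mul_bounded ug.1 mA AM) (Lp2Z (- C) lu).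
by rewrite /flux; under eq_fun do rewrite mulNr.
Qed.

(** For v in H^1_0 the advection term C int v u' becomes - C int u v'. What is
    left is linear in the density h alone, the values of v having disappeared. *)
Lemma aformE A b C M u v g h : measurable_fun setT (A \_ `]0, 1[) ->
  {ae @lebesgue_measure R, forall x, x \in `]0, 1[ -> `|A x| <= M} ->
  measurable_fun setT (b \_ `]0, 1[) ->
  {ae @lebesgue_measure R, forall x, x \in `]0, 1[ -> b x = C} ->
  L2_primitive 0 1 u g -> L2_primitive 0 1 v h -> v 0 = 0 -> v 1 = 0 ->
  aform A b u v = \int[mu]_(x in `]0, 1[) (flux A C u g x * h x).
Proof.
move=> mA AM mb bC ug vh v0 v1; have [lg uE] := ug; have [lh vE] := vh.
have lu := L2_primitive_Lp2 ler01 ug; have lv := L2_primitive_Lp2 ler01 vh.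
have [lwu _] := wderiv_L2_primitive ltr01 (L2_primitive_H1 ler01 ug).
have [lwv _] := wderiv_L2_primitive ltr01 (L2_primitive_H1 ler01 vh).
have wug := wderivE ltr01 ug; have wvh := wderivE ltr01 vh.
have bM : {ae @lebesgue_measure R, forall x, x \in `]0, 1[ -> `|b x| <= `|C|}.
  by apply: filterS bC => x bC /bC ->.
transitivity (\int[mu]_(x in `]0, 1[) (A x * g x * h x + C * v x * g x)).
  apply: ae_eq_Rintegral => //.
  - apply: measurable_funD; apply: integrable_measurable; apply: Lp2_integrable => //.
      exact: Lp2_mul_bounded AM.
    by under eq_fun do rewrite mulrC; exact: Lp2_mul_bounded bM.
  - apply: measurable_funD; apply: integrable_measurable; apply: Lp2_integrable => //.
      exact: Lp2_mul_bounded AM.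
    exact: Lp2Z.
  - near=> x => x01.
    have -> : wderiv 0 1 u x = g x by move: x01; near: x.
    have -> : wderiv 0 1 v x = h x by move: x01; near: x.
    have -> : b x = C by move: x01; near: x.
    by rewrite [v x * C]mulrC.
rewrite RintegralD//; last 2 first.
- by apply: Lp2_integrable => //; exact: Lp2_mul_bounded AM.
- by apply: Lp2_integrable => //; exact: Lp2Z.
rewrite [X in _ + X](_ : _ = - (C * \int[mu]_(x in `]0, 1[) (u x * h x))); last first.
  rewrite -mulrN -(H1_by_parts ug vh)// -RintegralZl//; last exact: Lp2_integrable.
  by apply: eq_Rintegral => x _; rewrite -mulrA [v x * _]mulrC.
rewrite -RintegralZl//; last exact: Lp2_integrable.
rewrite -RintegralB//.
- by apply: eq_Rintegral => x _; rewrite /flux mulrBl mulrA.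
- by apply: Lp2_integrable => //; exact: Lp2_mul_bounded AM.
- by apply: (integrableZl _ C (Lp2_integrable lu lh)).
Unshelve. all: by end_near. Qed.
End Advection_form.

(** * Orthogonality and coercivity *)

Section Galerkin.
Context {R : realType}.
Implicit Types (A b f g h u v : R -> R) (C : R).

Lemma flux_sum A C (I : Type) (s : seq I) (c : I -> R) (u g : I -> R -> R) h :
  (forall i, Lp 2%:E 0 1 (flux A C (u i) (g i))) -> Lp 2%:E 0 1 h ->
  \int[mu]_(y in `]0, 1[) (flux A C (fun x => \sum_(i <- s) c i * u i x)
                            (fun x => \sum_(i <- s) c i * g i x) y * h y) =
  \sum_(i <- s) c i * \int[mu]_(y in `]0, 1[) (flux A C (u i) (g i) y * h y).
Proof.
move=> lfl lh.
have fE y : flux A C (fun x => \sum_(i <- s) c i * u i x)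
    (fun x => \sum_(i <- s) c i * g i x) y = \sum_(i <- s) c i * flux A C (u i) (g i) y.
  rewrite /flux !mulr_sumr -sumrB; apply: eq_bigr => i _; ring.
under eq_Rintegral do rewrite fE.
elim: s {fE} => [|i s IH].
  rewrite big_nil; under eq_Rintegral do rewrite big_nil mul0r.
  by rewrite Rintegral_cst// mul0r.
rewrite big_cons -IH -RintegralZl//; last exact: Lp2_integrable.
rewrite -RintegralD//; last 2 first.
- by apply: (integrableZl _ (c i) (Lp2_integrable (lfl i) lh)).
- by apply: Lp2_integrable => //; apply: Lp2_sum => k; exact: Lp2Z.
by apply: eq_Rintegral => y _; rewrite big_cons mulrDl mulrA.
Qed.

Lemma coefficient_bounded A (m M : R) : 0 < m ->
  {ae @lebesgue_measure R, forall x, x \in `]0, 1[ -> m <= A x <= M} ->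
  {ae @lebesgue_measure R, forall x, x \in `]0, 1[ -> `|A x| <= M}.
Proof.
move=> m0; apply: filterS => x + x01 => /(_ x01)/andP[mAx AxM].
by rewrite ger0_norm// (le_trans _ mAx)// ltW.
Qed.

(** The integrand A g^2 is nonnegative with zero integral, hence zero almost
    everywhere, and A is bounded below by m > 0. *)
Lemma coercive_eq0 A m M g : 0 < m -> measurable_fun setT (A \_ `]0, 1[) ->
  {ae @lebesgue_measure R, forall x, x \in `]0, 1[ -> m <= A x <= M} ->
  Lp 2%:E 0 1 g -> \int[mu]_(x in `]0, 1[) (A x * g x * g x) = 0 ->
  {ae @lebesgue_measure R, forall x, x \in `]0, 1[ -> g x = 0}.
Proof.
move=> m0 mA AmM lg I0.
have AM := coefficient_bounded m0 AmM.
have iA := Lp2_integrable (Lp2_mul_bounded lg mA AM) lg.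
have mf := measurable_int _ iA.
have := (@ae_eq_integral_abs _ _ _ mu _ (measurable_itv `]0, 1[) _ mf).1.
move=> /(_ _)/wrap[].
  rewrite -[RHS](_ : ((\int[mu]_(x in `]0, 1[) (A x * g x * g x))%:E = 0)%E); last by rewrite I0.
  rewrite -EFin_Rintegral//; apply: ae_eq_integral => //.
    exact: measurableT_comp.
  apply: filterS AmM => x + x01 => /(_ x01)/andP[mAx AxM] /=.
  have A0 : 0 <= A x by rewrite (le_trans _ mAx)// ltW.
  by rewrite ger0_norm// -mulrA mulr_ge0// -expr2 sqr_ge0.
move=> H; near=> x => x01.
have /andP[mAx _] : m <= A x <= M by move: x01; near: x.
have [] : (A x * g x * g x)%:E = 0%E.
  by have : [set` `]0, 1[] x by []; near: x.
move=> /eqP; rewrite mulf_eq0 => /orP[|/eqP//]; rewrite mulf_eq0 => /orP[|/eqP//].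
by rewrite gt_eqF// (lt_le_trans m0).
Unshelve. all: by end_near. Qed.

Lemma mesh_le N (x : nat -> R) i j : mesh N x -> (i <= j)%N -> (j <= N.+1)%N ->
  x i <= x j.
Proof.
move=> [_ _ xS] ij; rewrite -(subnKC ij); elim: (j - i)%N => [|k IH].
  by rewrite addn0.
rewrite addnS ltnS => kN; rewrite (le_trans (IH (leqW kN)))// ltW//.
exact: xS.
Qed.

Lemma patch_itv_eq0 v (c d y : R) : v c = 0 -> v d = 0 -> (y <= c) || (d <= y) ->
  (v \_ `[c, d]) y = 0.
Proof.
move=> vc vd cyd; rewrite patchE; case: ifPn => //.
rewrite inE/= in_itv/= => /andP[cy yd]; case/orP: cyd => [yc|dy].
  by have -> : y = c by apply/eqP; rewrite eq_le yc cy.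
by have -> : y = d by apply/eqP; rewrite eq_le dy yd.
Qed.

(** A function vanishing at the nodes is a sum of bubbles. Instead of summing, one
    follows the primitive Q of K h: its increment over a mesh interval is the
    pairing of K with one bubble, so Q(x_j) = 0 for all j by induction, and
    Q(1) is the integral sought. *)
Lemma node_orthogonal N (x : nat -> R) (K v h : R -> R) : mesh N x ->
  Lp 2%:E 0 1 K ->
  (forall (j : 'I_N.+1) w k, L2_primitive (x j) (x j.+1) w k ->
    w (x j) = 0 -> w (x j.+1) = 0 ->
    \int[mu]_(y in `]0, 1[) (K y * (k \_ `](x j), (x j.+1)[) y) = 0) ->
  L2_primitive 0 1 v h -> (forall j, (j <= N.+1)%N -> v (x j) = 0) ->
  \int[mu]_(y in `]0, 1[) (K y * h y) = 0.
Proof.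
move=> hx lK Kb vh vx; have [x0 xN xS] := hx; have [lh _] := vh.
pose Q := primitive ((fun y => K y * h y) \_ `]0, 1[).
have lKh := Lp2_mul lK lh.
have Qx j : (j <= N.+1)%N -> Q (x j) = 0.
  elim: j => [_|j IH jN]; first by rewrite x0 /Q primitive_left.
  have xj0 : 0 <= x j by rewrite -x0 (mesh_le hx)// ltnW.
  have xj1 : x j.+1 <= 1 by rewrite -xN (mesh_le hx).
  have xj : x j <= x j.+1 by rewrite (mesh_le hx).
  have := primitive_restrict_itv lKh xj0 xj1 xj (lexx _).
  rewrite -/Q IH ?subr0; last exact: ltnW.
  move=> <-; have lKj := Lp2_mul (Lp2S xj0 xj1 lK) (Lp2S xj0 xj1 lh).
  rewrite (@primitive_supp_ge _ _ (x j.+1) _ lKj)//; last first.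
    by move=> t jt; rewrite patchE memNset//= in_itv/= andbC ltNge jt.
  have := Kb (Ordinal jN) v h (L2_primitiveS xj0 xj1 vh) (vx _ (ltnW jN)) (vx _ jN).
  move=> /= E; rewrite -[RHS]E [RHS]Rintegral_mkcond.
  apply: eq_Rintegral => y _; rewrite !patchE.
  case: ifPn => [yj|_]; last by rewrite mulr0; case: ifP.
  rewrite mem_set//; move: yj; rewrite inE/= !in_itv/= => /andP[jy yj].
  by rewrite (le_lt_trans xj0)//= (lt_le_trans yj).
have := Qx N.+1 (leqnn _); rewrite xN /Q (@primitive_supp_ge _ _ 1 _ lKh)//.
  by move=> E; rewrite Rintegral_mkcond.
by move=> t t1; rewrite patchE memNset//= in_itv/= andbC ltNge t1.
Qed.
End Galerkin.

(** * Exactness of the multiscale approximation *)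

Section Exactness.
Context {R : realType}.
Implicit Types (A b : R -> R) (C m M : R).

(** The difference e is an admissible test function, and the advection term drops
    out of the energy because int e e' is equal to its own opposite. *)
Lemma weak_solution_unique A b m M (u0 u1 : R) (u v : R -> R) : 0 < m ->
  Lp +oo%E 0 1 A ->
  {ae @lebesgue_measure R, forall x, x \in `]0, 1[ -> m <= A x <= M} ->
  Lp +oo%E 0 1 b -> divergence_free b ->
  weak_solution A b u0 u1 u -> weak_solution A b u0 u1 v ->
  {in `[0, 1], u =1 v}.
Proof.
move=> m0 lA AmM lb db [Hu ua uc su] [Hv va vc sv].
have mA := Lp_measurable lA; have AM := coefficient_bounded m0 AmM.
have mb := Lp_measurable lb; have [C bC] := divergence_free_cst lb db.
have ru := wderiv_L2_primitive ltr01 Hu; have rv := wderiv_L2_primitive ltr01 Hv.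
move: (wderiv 0 1 u) (wderiv 0 1 v) ru rv => g h ru rv.
pose e x := u x - v x; pose k x := g x - h x.
have re : L2_primitive 0 1 e k by exact: L2_primitiveB.
have e0 : e 0 = 0 by rewrite /e ua va subrr.
have e1 : e 1 = 0 by rewrite /e uc vc subrr.
have He : H10 0 1 e by split => //; exact: L2_primitive_H1 re.
have lk := re.1; have le := L2_primitive_Lp2 ler01 re.
have lfu := flux_Lp2 C mA AM ru; have lfv := flux_Lp2 C mA AM rv.
have fek : \int[mu]_(x in `]0, 1[) (flux A C e k x * k x) = 0.
  transitivity (aform A b u e - aform A b v e); last by rewrite su// sv// subrr.
  rewrite (aformE mA AM mb bC ru re)// (aformE mA AM mb bC rv re)//.
  rewrite -RintegralB//; [|exact: Lp2_integrable..].
  by apply: eq_Rintegral => x _; rewrite /flux /e /k; ring.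
have := H1_by_parts re re e0 e1.
rewrite [X in X = _ -> _](_ : _ = \int[mu]_(x in `]0, 1[) (e x * k x)); last first.
  by apply: eq_Rintegral => x _; rewrite mulrC.
(* By parts, int e e' = - int e e'. *)
move=> /eqP; rewrite -addr_eq0 -mulr2n mulrn_eq0/= => /eqP ek0.
have iA := Lp2_integrable (Lp2_mul_bounded lk mA AM) lk.
have iC := Lp2_integrable le lk.
have : \int[mu]_(x in `]0, 1[) (A x * k x * k x - C * (e x * k x)) = 0.
  by rewrite -[RHS]fek; apply: eq_Rintegral => x _; rewrite /flux; ring.
rewrite RintegralB//; last by apply: (integrableZl _ C iC).
rewrite RintegralZl// ek0 mulr0 subr0 => I0.
have k0 := coercive_eq0 m0 mA AmM lk I0.
move=> x x01; apply/eqP; rewrite -subr_eq0 -/(e x) (re.2 x x01) e0 add0r; apply/eqP.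
transitivity (primitive (cst 0 : R -> R) x); last exact: (@primitive_supp _ _ x).
apply: eq_primitive; [exact: Lp2_L1|exact: integrable0|].
by apply: filterS k0 => y ky _; rewrite patchE; case: ifPn => //; rewrite inE => /ky.
Qed.

(** A test function v is split into its interpolant in the multiscale space, where
    the Galerkin equations apply, and a remainder vanishing at the nodes, where
    the equations of the basis functions apply, by linearity in the first
    argument of the form. *)
Lemma adv_msfem_solution_weak A b m M N (x : nat -> R) (phi : 'I_N.+2 -> R -> R)
    (u0 u1 : R) (uH : R -> R) : 0 < m ->
  Lp +oo%E 0 1 A ->
  {ae @lebesgue_measure R, forall x, x \in `]0, 1[ -> m <= A x <= M} ->
  Lp +oo%E 0 1 b -> divergence_free b -> mesh N x ->
  adv_msfem_basis A b x phi -> adv_msfem_solution A b phi u0 u1 uH ->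
  weak_solution A b u0 u1 uH.
Proof.
move=> m0 lA AmM lb db hx hphi [[c uHE] uH0 uH1 sH].
have [x0 xN xS] := hx.
have mA := Lp_measurable lA; have AM := coefficient_bounded m0 AmM.
have mb := Lp_measurable lb; have [C bC] := divergence_free_cst lb db.
pose g i := wderiv 0 1 (phi i).
have rphi i : L2_primitive 0 1 (phi i) (g i) by apply: wderiv_L2_primitive => //; case: (hphi i).
have rH : L2_primitive 0 1 uH (fun y => \sum_i c i * g i y).
  by apply: eq_L2_primitive (L2_primitive_sum _ c rphi) => // y y01; rewrite uHE.
set gH := (fun y => _) in rH.
have lK : Lp 2%:E 0 1 (flux A C uH gH) by exact: flux_Lp2 AM _.
have KE h : Lp 2%:E 0 1 h -> \int[mu]_(y in `]0, 1[) (flux A C uH gH y * h y) =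
    \sum_i c i * \int[mu]_(y in `]0, 1[) (flux A C (phi i) (g i) y * h y).
  move=> lh; rewrite -flux_sum//; last by move=> i; exact: flux_Lp2 AM _.
  apply: eq_Rintegral => y; rewrite inE => y01; rewrite /flux uHE//.
  exact: subset_itv_oo_cc.
have bubble (j : 'I_N.+1) w k : L2_primitive (x j) (x j.+1) w k ->
    w (x j) = 0 -> w (x j.+1) = 0 ->
    \int[mu]_(y in `]0, 1[) (flux A C uH gH y * (k \_ `](x j), (x j.+1)[) y) = 0.
  move=> rw wj wj1.
  have xj0 : 0 <= x j by rewrite -x0 (mesh_le hx)// ltnW// ltnS ltnW.
  have xj1 : x j.+1 <= 1 by rewrite -xN (mesh_le hx).
  have xj : x j <= x j.+1 by rewrite (mesh_le hx).
  have rw' := L2_primitive_ext0 xj0 xj xj1 rw wj wj1.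
  rewrite KE; last exact: rw'.1.
  apply: big1 => i _; rewrite -(aformE mA AM mb bC (rphi i) rw'); last 2 first.
  - by apply: patch_itv_eq0; rewrite ?xj0.
  - by apply: patch_itv_eq0; rewrite ?xj1 ?orbT.
  have [_ _ ->] := hphi i; first by rewrite mulr0.
  by split => //; exact: L2_primitive_H1 rw.
split => //; first exact: L2_primitive_H1 rH.
move=> v [Hv v0 v1]; have rv := wderiv_L2_primitive ltr01 Hv.
(* The interpolant of v; it is an admissible discrete test function, as it takes
   the values v(0) = v(1) = 0 at the first and last nodes. *)
pose vH y := \sum_(i < N.+2) v (x i) * phi i y.
have rvH : L2_primitive 0 1 vH (fun y => \sum_(i < N.+2) v (x i) * g i y).
  exact: (L2_primitive_sum (index_enum 'I_N.+2) (fun i : 'I_N.+2 => v (x i)) rphi).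
have vHx (j : 'I_N.+2) : vH (x j) = v (x j).
  rewrite /vH (bigD1 j)//= big1 ?addr0.
    by have [_ -> _] := hphi j; rewrite eqxx mulr1.
  by move=> i ij; have [_ -> _] := hphi i; rewrite (negbTE ij) mulr0.
have vH0 : vH 0 = 0 by have := vHx ord0; rewrite /= x0 v0.
have vH1 : vH 1 = 0 by have := vHx ord_max; rewrite /= xN v1.
have rd := L2_primitiveB rv rvH.
have EvH : \int[mu]_(y in `]0, 1[)
    (flux A C uH gH y * (\sum_(i < N.+2) v (x i) * g i y)) = 0.
  rewrite -(aformE mA AM mb bC rH rvH)//; apply: sH; last first.
    by split => //; exact: L2_primitive_H1 rvH.
  by exists (fun i => v (x i)).
have Ed : \int[mu]_(y in `]0, 1[) (flux A C uH gH y *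
    (wderiv 0 1 v y - \sum_(i < N.+2) v (x i) * g i y)) = 0.
  apply: (node_orthogonal hx lK bubble rd) => j jN.
  have := vHx (Ordinal (jN : (j < N.+2)%N)) => /= ->; exact: subrr.
rewrite (aformE mA AM mb bC rH rv)//.
transitivity (\int[mu]_(y in `]0, 1[) (flux A C uH gH y *
    ((\sum_(i < N.+2) v (x i) * g i y) +
     (wderiv 0 1 v y - \sum_(i < N.+2) v (x i) * g i y)))).
  by apply: eq_Rintegral => y _; rewrite subrKC.
by rewrite Rintegral_L2D ?EvH ?Ed ?addr0//; [exact: rvH.1|exact: rd.1].
Qed.
End Exactness.

Theorem lemma2p3 (R : realType) (A b : R -> R) (m M : R)
  (hm : 0 < m) (hmM : m <= M)
  (hA : Lp +oo%E 0 1 A)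
  (hAmM : {ae @lebesgue_measure R, forall x, x \in `]0, 1[ -> m <= A x <= M})
  (hb : Lp +oo%E 0 1 b) (hbdiv : divergence_free b)
  (N : nat) (x : nat -> R) (hx : mesh N x)
  (phi : 'I_N.+2 -> R -> R) (hphi : adv_msfem_basis A b x phi)
  (u0 u1 : R) (u uH : R -> R)
  (hu : weak_solution A b u0 u1 u)
  (huH : adv_msfem_solution A b phi u0 u1 uH) :
  {in `[0, 1], uH =1 u}.
Proof.
have hw := adv_msfem_solution_weak hm hA hAmM hb hbdiv hx hphi huH.
exact: (weak_solution_unique hm hA hAmM hb hbdiv hw hu).
Qed.
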